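(* Let $n\ge 2$, let $(L,[\cdot,\dots,\cdot],\varepsilon,\alpha)$ be an $n$-Hom-Lie color algebra and let $\beta:L\to L$ be an even endomorphism of $L$. Then $L_\beta=(L,\{\cdot,\dots,\cdot\},\varepsilon,\beta\alpha)$, where $\{x_1,\dots,x_n\}=\beta([x_1,\dots,x_n])$, is an $n$-Hom-Lie color algebra. Moreover, suppose $(L',[\cdot,\dots,\cdot]',\varepsilon,\alpha')$ is another $n$-Hom-Lie color algebra (same $G$ and $\varepsilon$) and $\beta'$ is an even endomorphism of $L'$. If $f:(L,[\cdot,\dots,\cdot],\varepsilon,\alpha)\to(L',[\cdot,\dots,\cdot]',\varepsilon,\alpha')$ is a morphism such that $f\beta=\beta' f$, then $f:L_\beta\to L'_{\beta'}$ is also a morphism, where $L'_{\beta'}=(L',\beta'[\cdot,\dots,\cdot]',\varepsilon,\beta'\alpha')$.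
   Context: $G$ is an abelian group with neutral element $e$ (operation written $+$), $\mathbb{K}$ is a field of characteristic different from 2. A $G$-graded linear space is $V=\bigoplus_{a\in G}V_a$ over $\mathbb{K}$; $\mathcal{H}(V)$ is its set of homogeneous elements; a linear map $f:V\to V'$ is even if $f(V_a)\subseteq V'_a$ for all $a$. A (skew-symmetric) bicharacter is a map $\varepsilon:G\times G\to\mathbb{K}^*$ with $\varepsilon(a,b)\varepsilon(b,a)=1$, $\varepsilon(a,b+c)=\varepsilon(a,b)\varepsilon(a,c)$, $\varepsilon(a+b,c)=\varepsilon(a,c)\varepsilon(b,c)$. For homogeneous $x,y$ one writes $\varepsilon(x,y)$ for $\varepsilon(\deg x,\deg y)$, and sums of homogeneous elements inside $\varepsilon$ denote sums of their degrees. An $n$-Hom-Lie color algebra $(L,[\cdot,\dots,\cdot],\varepsilon,\alpha)$ is a $G$-graded linear space $L$ with an $n$-linear map $[\cdot,\dots,\cdot]:L^n\to L$, a bicharacter $\varepsilon$ and an even linear map $\alpha:L\to L$ such that for all $x_i,y_j\in\mathcal{H}(L)$: (1) $[x_1,\dots,x_i,x_{i+1},\dots,x_n]=-\varepsilon(x_i,x_{i+1})[x_1,\dots,x_{i+1},x_i,\dots,x_n]$ for $1\le i\le n-1$; (2) $[\alpha(x_1),\dots,\alpha(x_{n-1}),[y_1,\dots,y_n]]=\sum_{i=1}^n\varepsilon(X,Y_i)[\alpha(y_1),\dots,\alpha(y_{i-1}),[x_1,\dots,x_{n-1},y_i],\alpha(y_{i+1}),\dots,\alpha(y_n)]$, where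 $X=x_1+\dots+x_{n-1}$, $Y_i=y_1+\dots+y_{i-1}$ (sums of degrees, $Y_1=e$). An endomorphism of $L$ is a linear map $\beta:L\to L$ with $\beta([x_1,\dots,x_n])=[\beta(x_1),\dots,\beta(x_n)]$. A morphism $f:(L,[\cdot,\dots,\cdot],\varepsilon,\alpha)\to(L',[\cdot,\dots,\cdot]',\varepsilon,\alpha')$ is an even linear map $f:L\to L'$ with $f\circ\alpha=\alpha'\circ f$ and $f([x_1,\dots,x_n])=[f(x_1),\dots,f(x_n)]'$ for all $x_i\in\mathcal{H}(L)$. *)

(* Defs.v *)
From HB Require Import structures.
From mathcomp Require Import all_boot all_order all_fingroup all_algebra.

Set Implicit Arguments.
Unset Strict Implicit.
Unset Printing Implicit Defensive.

Import GRing.Theory.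
Local Open Scope ring_scope.

(* A decomposition of L as the internal direct sum of the subspaces
   component a, for a in G.  Neither G nor L is assumed finite(-dimensional),
   so sums range over finite sequences of degrees.  The element 0 lies in
   every component, hence has no well-defined degree: below, degrees are
   always quantified together with membership in the component. *)
Record grading (G : zmodType) (K : fieldType) (L : lmodType K) := Grading {
  component :> G -> L -> Prop;
  component0 : forall a, component a 0;
  componentP : forall a (c : K) (u v : L),
    component a u -> component a v -> component a (c *: u + v);
  component_gen : forall x : L, exists (s : seq G) (v : G -> L),
    (forall a, component a (v a)) /\ x = \sum_(a <- s) v a;
  component_free : forall (s : seq G) (v : G -> L), uniq s ->
    (forall a, component a (v a)) -> \sum_(a <- s) v a = 0 ->
    forall a, a \in s -> v a = 0
}.

Definition homogeneous (G : zmodType) (K : fieldType) (L : lmodType K)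
    (V : grading G L) (x : L) : Prop :=
  exists a : G, V a x.

Definition even (G : zmodType) (K : fieldType) (L L' : lmodType K)
    (V : grading G L) (V' : grading G L') (f : L -> L') : Prop :=
  forall (a : G) (x : L), V a x -> V' a (f x).

Record bicharacter (G : zmodType) (K : fieldType) := Bicharacter {
  bichar :> G -> G -> K;
  bichar_neq0 : forall a b, bichar a b != 0;
  bichar_skew : forall a b, bichar a b * bichar b a = 1;
  bicharDr : forall a b c, bichar a (b + c) = bichar a b * bichar a c;
  bicharDl : forall a b c, bichar (a + b) c = bichar a c * bichar b c
}.

(* (x_1, ..., x_(i-1), u, x_(i+1), ..., x_n) *)
Definition replace (T : Type) (n : nat) (x : {ffun 'I_n -> T}) (i : 'I_n)
    (u : T) : {ffun 'I_n -> T} :=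
  [ffun j => if j == i then u else x j].

(* (x_1, ..., x_(n-1), z): the partial injection insub is None exactly at the
   last index of 'I_n. *)
Definition append (T : Type) (n : nat) (x : {ffun 'I_n.-1 -> T}) (z : T) :
    {ffun 'I_n -> T} :=
  [ffun j : 'I_n => if insub (val j) is Some k then x k else z].

Definition multilinear (K : fieldType) (L : lmodType K) (n : nat)
    (br : {ffun 'I_n -> L} -> L) : Prop :=
  forall (x : {ffun 'I_n -> L}) (i : 'I_n) (c : K) (u v : L),
    br (replace x i (c *: u + v)) = c *: br (replace x i u) + br (replace x i v).

Definition color_skewsymmetric (G : zmodType) (K : fieldType) (L : lmodType K)
    (n : nat) (V : grading G L) (br : {ffun 'I_n -> L} -> L)
    (eps : bicharacter G K) : Prop :=
  forall (x : {ffun 'I_n -> L}) (d : 'I_n -> G),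
    (forall k, V (d k) (x k)) ->
    forall i j : 'I_n, val j = (val i).+1 ->
      br x = - (eps (d i) (d j) *: br [ffun k => x (tperm i j k)]).

Definition color_hom_identity (G : zmodType) (K : fieldType) (L : lmodType K)
    (n : nat) (V : grading G L) (br : {ffun 'I_n -> L} -> L)
    (eps : bicharacter G K) (alpha : L -> L) : Prop :=
  forall (x : {ffun 'I_n.-1 -> L}) (y : {ffun 'I_n -> L})
         (dx : 'I_n.-1 -> G) (dy : 'I_n -> G),
    (forall i, V (dx i) (x i)) -> (forall i, V (dy i) (y i)) ->
    br (append [ffun i => alpha (x i)] (br y)) =
    \sum_(i < n)
      eps (\sum_(k < n.-1) dx k) (\sum_(j < n | (j < i)%N) dy j) *:
        br (replace [ffun j => alpha (y j)] i (br (append x (y i)))).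

Record is_nHomLieColor (G : zmodType) (K : fieldType) (L : lmodType K)
    (n : nat) (V : grading G L) (br : {ffun 'I_n -> L} -> L)
    (eps : bicharacter G K) (alpha : {linear L -> L}) : Prop := {
  nHLC_multilinear : multilinear br;
  nHLC_even : even V V alpha;
  nHLC_skew : color_skewsymmetric V br eps;
  nHLC_identity : color_hom_identity V br eps alpha
}.

Definition is_endomorphism (K : fieldType) (L : lmodType K) (n : nat)
    (br : {ffun 'I_n -> L} -> L) (beta : {linear L -> L}) : Prop :=
  forall x : {ffun 'I_n -> L}, beta (br x) = br [ffun i => beta (x i)].

Record is_morphism (G : zmodType) (K : fieldType) (L L' : lmodType K) (n : nat)
    (V : grading G L) (br : {ffun 'I_n -> L} -> L) (alpha : {linear L -> L})
    (V' : grading G L') (br' : {ffun 'I_n -> L'} -> L')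
    (alpha' : {linear L' -> L'}) (f : {linear L -> L'}) : Prop := {
  morphism_even : even V V' f;
  morphism_twist : forall x : L, f (alpha x) = alpha' (f x);
  morphism_bracket : forall x : {ffun 'I_n -> L},
    (forall i, homogeneous V (x i)) ->
    f (br x) = br' [ffun i => f (x i)]
}.

Definition twist_bracket (K : fieldType) (L : lmodType K) (n : nat)
    (beta : {linear L -> L}) (br : {ffun 'I_n -> L} -> L) :
    {ffun 'I_n -> L} -> L :=
  fun x => beta (br x).

(* Main.v *)
(* Since beta is an endomorphism of the bracket, both sides of each axiom for
   the twisted structure are the image under beta (or under beta twice, for the
   Hom-identity) of the same axiom for L. *)

Require Import Defs.
From HB Require Import structures.
From mathcomp Require Import all_boot all_order all_fingroup all_algebra.
Import GRing.Theory.
Local Open Scope ring_scope.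

(** Read from right to left with [g := beta], this and [map_replace] gather the [beta] on every slot
    into one entrywise image, the form from which [beta_endo] pulls [beta] out of the bracket. *)
Lemma map_append (T U : Type) (n : nat) (g : T -> U)
    (x : {ffun 'I_n.-1 -> T}) (z : T) :
  [ffun j => g (append x z j)] = append [ffun i => g (x i)] (g z) :> {ffun 'I_n -> U}.
Proof. by apply/ffunP=> j; rewrite !ffunE; case: insub => [k|//]; rewrite ffunE. Qed.

Lemma map_replace (T U : Type) (n : nat) (g : T -> U)
    (x : {ffun 'I_n -> T}) (i : 'I_n) (u : T) :
  [ffun j => g (replace x i u j)] = replace [ffun j => g (x j)] i (g u).
Proof. by apply/ffunP=> j; rewrite !ffunE; case: ifP. Qed.

Lemma twist_nHomLieColor (G : zmodType) (K : fieldType) (n : nat)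
    (eps : bicharacter G K) (L : lmodType K) (V : grading G L)
    (br : {ffun 'I_n -> L} -> L) (alpha beta : {linear L -> L}) :
  is_nHomLieColor V br eps alpha -> even V V beta -> is_endomorphism br beta ->
  is_nHomLieColor V (twist_bracket beta br) eps (beta \o alpha).
Proof.
move=> [br_lin alpha_even br_skew br_id] beta_even beta_endo.
split.
- by move=> x i c u v; rewrite /twist_bracket br_lin linearP.
- by move=> a x Vx; apply/beta_even/alpha_even.
- move=> x d Vx i j ij.
  by rewrite /twist_bracket (br_skew x d Vx i j ij) linearN linearZ.
- move=> x y dx dy Vx Vy; rewrite /twist_bracket.
  (* The length [m] is free because this serves both [x] (length [n.-1]) and [y] (length [n]). *)
  have comp_ffun m (z : {ffun 'I_m -> L}) :
      [ffun i => (beta \o alpha) (z i)] =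
      [ffun i => beta ([ffun j => alpha (z j)] i)].
    by apply/ffunP=> i; rewrite !ffunE.
  (* The left side becomes [beta (beta (br (append [ffun i => alpha (x i)] (br y))))]. The identity
     of [L] is then used at the original [x] and [y], so the degrees and the [eps] factors are
     already the required ones. *)
  rewrite comp_ffun -map_append -beta_endo (br_id x y dx dy Vx Vy) !linear_sum.
  apply: eq_bigr => i _.
  (* In the [i]-th summand slot [i] holds [beta (br (append x (y i)))] and every other slot
     [beta (alpha (y j))], so here too a second [beta] comes out. *)
  by rewrite comp_ffun -map_replace -beta_endo !linearZ.
Qed.

(** Twisting keeps the gradings, so evenness of [f] carries over. For the other two clauses, [f]
    first crosses the outer [beta], turning it into [beta'], and then meets the untwisted [alpha] or
    [br]. *)
Lemma twist_morphism (G : zmodType) (K : fieldType) (n : nat)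
    (L L' : lmodType K) (V : grading G L) (V' : grading G L')
    (br : {ffun 'I_n -> L} -> L) (br' : {ffun 'I_n -> L'} -> L')
    (alpha beta : {linear L -> L}) (alpha' beta' : {linear L' -> L'})
    (f : {linear L -> L'}) :
  is_morphism V br alpha V' br' alpha' f ->
  (forall x : L, f (beta x) = beta' (f x)) ->
  is_morphism V (twist_bracket beta br) (beta \o alpha)
              V' (twist_bracket beta' br') (beta' \o alpha') f.
Proof.
move=> [f_even f_alpha f_br] f_beta; split=> // [x|x hx].
  by rewrite /= f_beta f_alpha.
by rewrite /twist_bracket f_beta f_br.
Qed.

Theorem theorem3p4 (G : zmodType) (K : fieldType)
    (charK : 2%N \notin [pchar K]) (n : nat) (hn : (2 <= n)%N)
    (eps : bicharacter G K)
    (L : lmodType K) (V : grading G L) (br : {ffun 'I_n -> L} -> L)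
    (alpha : {linear L -> L}) (hL : is_nHomLieColor V br eps alpha)
    (beta : {linear L -> L}) (beta_even : even V V beta)
    (beta_endo : is_endomorphism br beta) :
  is_nHomLieColor V (twist_bracket beta br) eps (beta \o alpha) /\
  (forall (L' : lmodType K) (V' : grading G L') (br' : {ffun 'I_n -> L'} -> L')
      (alpha' : {linear L' -> L'}) (beta' : {linear L' -> L'})
      (f : {linear L -> L'}),
    is_nHomLieColor V' br' eps alpha' ->
    even V' V' beta' -> is_endomorphism br' beta' ->
    is_morphism V br alpha V' br' alpha' f ->
    (forall x : L, f (beta x) = beta' (f x)) ->
    is_morphism V (twist_bracket beta br) (beta \o alpha)
                V' (twist_bracket beta' br') (beta' \o alpha') f).
Proof.
split; first exact: twist_nHomLieColor.
by move=> L' V' br' alpha' beta' f _ _ _; apply: twist_morphism.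
Qed.
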